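(* Let $u_0\in\mathcal{V}_{D,0}$, $\beta_0\in\mathcal{B}$ be the initial state and, for $n=0,\dots,N-1$, let $(u_{n+1},\beta_{n+1})\in\mathcal{V}_{D,0}\times\mathbb{C}_n$ be a solution of the incremental minimization problem, i.e. a minimizer of $(u,\beta)\mapsto\mathcal{E}(t_{n+1},u,\beta)+\mathcal{D}(\beta_n,\beta)$ over $\mathcal{V}_{D,0}\times\mathbb{C}_n$. Then for $n=0,\dots,N-1$ the following estimates hold. (i) (Stability) $$\mathcal{E}(t_{n+1},u_{n+1},\beta_{n+1})\le\mathcal{E}(t_{n+1},\tilde u,\tilde\beta)+\mathcal{D}(\beta_n,\tilde\beta)\quad\text{for all }(\tilde u,\tilde\beta)\in\mathcal{V}_{D,0}\times\mathbb{C}_n.$$ (ii) (Upper bound) $$\mathcal{E}(t_{n+1},u_{n+1},\beta_{n+1})-\mathcal{E}(t_n,u_n,\beta_n)+\mathcal{D}(\beta_n,\beta_{n+1})\le\mathcal{E}(t_{n+1},u_n,\beta_n)-\mathcal{E}(t_n,u_n,\beta_n)=:UB_{n,n+1}.$$ (iii) (Lower bound) $$\mathcal{E}(t_{n+1},u_{n+1},\beta_{n+1})-\mathcal{E}(t_n,u_n,\beta_n)+\mathcal{D}(\beta_n,\beta_{n+1})\ge\mathcal{E}(t_{n+1},u_{n+1},\beta_{n+1})-\mathcal{E}(t_n,u_{n+1},\beta_{n+1})=:LB_{n,n+1}.$$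
   Context: $\Omega\subset\mathbb{R}^d$, $d\in\{1,2,3\}$, is a bounded open domain with boundary split into a Dirichlet part $\partial\Omega_D$ and the remaining part $\partial\Omega_N$, with outward normal $\nu$ defined a.e. on $\partial\Omega$. $0=t_0<t_1<\dots<t_N=T$ is a partition of $[0,T]$. Only Dirichlet loading is considered: the displacement $w(\cdot,t)$ is prescribed on $\partial\Omega_D$, and body forces and surface tractions are zero. $\varepsilon(u)=(\nabla u+\nabla u^T)/2$. Spaces: $\mathcal{V}\subset H^1(\Omega;\mathbb{R}^d)$ is the space of displacement fields generating compatible strain fields; $\mathcal{V}_{D,0}=\{u\in\mathcal{V}:u=0\text{ on }\partial\Omega_D\}$; $u_{D,m}\in\mathcal{V}$ is a fixed lifting of the boundary datum $w(\cdot,t_m)$ (so $u_{D,m}=w(\cdot,t_m)$ on $\partial\Omega_D$). $\mathcal{B}=\{\gamma\in W^{1,\infty}(\Omega;\mathbb{R}):\nabla\gamma\cdot\nu=0\text{ on }\partial\Omega\}$. The admissible set of damage fields at the step $[t_n,t_{n+1}]$ is $\mathbb{C}_n=\{\beta\in\mathcal{B}:0\le\beta\le1\text{ and }\beta\ge\beta_n\text{ a.e. in }\Omega\}$. The damage fields take values in $[0,1]$, including the initial one $\beta_0$. Functionals: for $u\in\mathcal{V}_{D,0}$, $$\mathcal{E}(t_m,u,\beta)=\int_\Omega\left[R(\beta)\psi_0^+(\varepsilon(u+u_{D,m}))+\psi_0^-(\varepsilon(u+u_{D,m}))+\frac{g_c\ell}{2}|\nabla\beta|^2\right]dx,$$ and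 for $\beta,\beta'$ with $\beta'\ge\beta$, $$\mathcal{D}(\beta,\beta')=\int_\Omega\frac{g_c}{2\ell}\left(\beta'^2-\beta^2\right)dx.$$ Here $g_c>0$ is the fracture toughness, $\ell>0$ a length, $\psi_0^{\pm}$ the ''tensile'' and ''compressive'' parts of the elastic strain energy density $\psi_0$ (obtained, for instance, from the volumetric-deviatoric splitting or the spectral decomposition of the strain tensor), and $R(\beta)=g(\beta)+k$ with $g$ decreasing, convex, Lipschitz, $g(0)=1$, $g(1)=0$, and $k>0$ a small parameter.
   Formalization: The lower bound (iii) for n=0 is proved only if the initial state is stable at t_0, i.e. E(t_0,u_0,β_0) ≤ E(t_0,ũ,β̃)+D(β_0,β̃) for all (ũ,β̃) in V_{D,0}×C_0; for an arbitrary initial state it is false. *)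

(* Defs.v *)
From HB Require Import structures.
From mathcomp Require Import all_boot all_order all_algebra.
From mathcomp Require Import all_classical all_reals all_analysis.
Set Implicit Arguments.
Unset Strict Implicit.
Unset Printing Implicit Defensive.
Import Order.TTheory GRing.Theory Num.Theory.
Import numFieldNormedType.Exports.
Local Open Scope classical_set_scope.
Local Open Scope ring_scope.

(* R^d is 'rV[R]_d, whose library topology is the usual one.  Its sigma-algebra
   is generated by the coordinates, as the library does for n.-tuple T. *)
Definition rV_display : measure_display. Proof. exact. Qed.

Section measurable_rV.
Context {R : realType} (d : nat).

Let coord (i : 'I_d) (x : 'rV[R]_d) : measurableTypeR R := x 0 i.

Let rV_set0 : g_sigma_preimage coord set0.
Proof. exact: sigma_algebra0. Qed.

Let rV_setC A : g_sigma_preimage coord A -> g_sigma_preimage coord (~` A).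
Proof. exact: sigma_algebraC. Qed.

Let rV_bigcup (F : (set 'rV[R]_d)^nat) :
  (forall i, g_sigma_preimage coord (F i)) ->
  g_sigma_preimage coord (\bigcup_i (F i)).
Proof. exact: sigma_algebra_bigcup. Qed.

HB.instance Definition _ := @isMeasurable.Build rV_display
  'rV[R]_d (g_sigma_preimage coord) rV_set0 rV_setC rV_bigcup.

Lemma measurable_rV_coord (i : 'I_d) :
  measurable_fun [set: 'rV[R]_d] (fun x : 'rV[R]_d => x 0 i : measurableTypeR R).
Proof.
move=> _ Y mY; rewrite setTI; apply: sub_sigma_algebra => /=.
rewrite -bigcup_seq/=; exists i => /=; first by rewrite mem_index_enum.
by exists Y => //; rewrite setTI.
Qed.

End measurable_rV.

Section lebesgue_rV.
Context {R : realType}.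

Lemma measurable_fun_rVP d' (T : measurableType d') d (f : T -> 'rV[R]_d) :
  (forall i, measurable_fun [set: T] (fun t => f t 0 i : measurableTypeR R)) ->
  measurable_fun [set: T] f.
Proof.
move=> mf _ Y; rewrite {1}/measurable/= => mY; rewrite setTI.
pose F := image_set_system [set: T] f measurable.
suff : F Y by rewrite /F /image_set_system /= setTI.
apply: mY; split => [|A]; first exact/sigma_algebra_image/sigma_algebra_measurable.
rewrite -bigcup_seq => -[i _ [B mB <-]].
by rewrite /F /image_set_system /= !setTI; have := mf i measurableT B mB;
  rewrite setTI.
Qed.

Definition rV_cons d (p : measurableTypeR R * 'rV[R]_d) : 'rV[R]_d.+1 :=
  \row_i oapp (p.2 0) p.1 (unlift ord0 i).

Definition rV_uncons d (x : 'rV[R]_d.+1) : measurableTypeR R * 'rV[R]_d :=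
  (x 0 0, \row_i x 0 (lift ord0 i)).

Lemma rV_consK d : cancel (@rV_cons d) (@rV_uncons d).
Proof.
move=> [a x]; rewrite /rV_uncons /rV_cons !mxE unlift_none /=; congr pair.
by apply/rowP => i; rewrite !mxE liftK.
Qed.

Lemma measurable_rV_cons d : measurable_fun [set: _] (@rV_cons d).
Proof.
apply: measurable_fun_rVP => i; rewrite /rV_cons.
case: (unliftP ord0 i) => [j|] ->.
  rewrite [X in measurable_fun _ X](_ : _ = (fun x : 'rV[R]_d => x 0 j) \o snd);
    last by apply/funext => p; rewrite /= mxE liftK.
  by apply: measurableT_comp => //; exact: measurable_rV_coord.
rewrite [X in measurable_fun _ X](_ : _ = fst)//.
by apply/funext => p; rewrite /= mxE unlift_none.
Qed.

Lemma measurable_rV_uncons d : measurable_fun [set: _] (@rV_uncons d).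
Proof.
apply/measurable_fun_pairP; split; first exact: measurable_rV_coord.
apply: measurable_fun_rVP => i.
rewrite [X in measurable_fun _ X](_ : _ = fun x : 'rV[R]_d.+1 => x 0 (lift ord0 i)).
  exact: measurable_rV_coord.
by apply/funext => x /=; rewrite mxE.
Qed.

Section succ.
Variables (d : nat) (m : {sigma_finite_measure set 'rV[R]_d -> \bar R}).

Definition lebesgue_succ : set 'rV[R]_d.+1 -> \bar R :=
  pushforward (@lebesgue_measure R \x m)%E (@rV_cons d).

Let lebesgue_succ0 : lebesgue_succ set0 = 0%E.
Proof. by rewrite /lebesgue_succ /pushforward preimage_set0 measure0. Qed.

Let lebesgue_succ_ge0 A : (0 <= lebesgue_succ A)%E.
Proof. by rewrite /lebesgue_succ /pushforward; exact: measure_ge0. Qed.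

Let lebesgue_succ_sigma_additive : semi_sigma_additive lebesgue_succ.
Proof.
have mcons B : measurable B -> measurable (@rV_cons d @^-1` B).
  by move=> mB; rewrite -[X in measurable X]setTI; exact: measurable_rV_cons.
move=> F mF tF mUF; rewrite /lebesgue_succ /pushforward preimage_bigcup.
apply: (@measure_semi_sigma_additive _ _ _ (@lebesgue_measure R \x m)%E).
- by move=> n; exact: mcons.
- apply/trivIsetP => /= i j _ _ ij; rewrite -preimage_setI.
  by move/trivIsetP : tF => /(_ _ _ _ _ ij) ->//; rewrite preimage_set0.
- by rewrite -preimage_bigcup; exact: mcons.
Qed.

HB.instance Definition _ := isMeasure.Build _ _ _ lebesgue_succ
  lebesgue_succ0 lebesgue_succ_ge0 lebesgue_succ_sigma_additive.

Let lebesgue_succ_sigma_finite : sigma_finite setT lebesgue_succ.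
Proof.
have [F FT Foo] : sigma_finite setT (@lebesgue_measure R \x m)%E.
  have /sigma_finiteP[F [TF ndF Foo]] := sigma_finiteT (@lebesgue_measure R).
  have /sigma_finiteP[G [TG ndG Goo]] := sigma_finiteT m.
  exists (fun n => F n `*` G n) => [|n].
    rewrite -setXTT TF TG predeqE => -[x y]; split.
      move=> [/= [n _ Fnx] [k _ Gky]]; exists (maxn n k) => //; split.
      - by move: x Fnx; exact/subsetPset/ndF/leq_maxl.
      - by move: y Gky; exact/subsetPset/ndG/leq_maxr.
    by move=> [n _ []/= ? ?]; split; exists n.
  have [? ?] := Foo n; have [? ?] := Goo n.
  split; first exact: measurableX.
  by rewrite product_measure1E// lte_mul_pinfty// ge0_fin_numE.
exists (fun k => @rV_uncons d @^-1` F k).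
  by rewrite -preimage_bigcup -FT preimage_setT.
move=> k; have [mF Fk] := Foo k; split.
  by rewrite -[X in measurable X]setTI; exact: measurable_rV_uncons.
rewrite /lebesgue_succ /pushforward -comp_preimage.
by rewrite (_ : _ \o _ = id)//; apply/funext => p /=; rewrite rV_consK.
Qed.

HB.instance Definition _ := Measure_isSigmaFinite.Build _ _ _ lebesgue_succ
  lebesgue_succ_sigma_finite.

End succ.

Section zero.
Let lebesgue0_sigma_finite : sigma_finite setT (@dirac _ 'rV[R]_0 0 R).
Proof.
by apply: fin_num_fun_sigma_finite; [rewrite measure0|exact: fin_num_measure].
Qed.

Definition lebesgue_zero : set 'rV[R]_0 -> \bar R := @dirac _ 'rV[R]_0 0 R.
HB.instance Definition _ := Measure.on lebesgue_zero.
HB.instance Definition _ := Measure_isSigmaFinite.Build _ _ _ lebesgue_zero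
  lebesgue0_sigma_finite.
End zero.

(* d-dimensional Lebesgue measure, as an iterated product. *)
Fixpoint lebesgue_rV d : {sigma_finite_measure set 'rV[R]_d -> \bar R} :=
  if d is d'.+1 then lebesgue_succ (lebesgue_rV d') else lebesgue_zero.

End lebesgue_rV.

Section euclidean.
Context {R : realType} {d : nat}.
Implicit Types (x y v : 'rV[R]_d) (A : set 'rV[R]_d).

Definition dotv x y : R := \sum_i x 0 i * y 0 i.

(* The library norm of 'rV is the sup norm. *)
Definition enorm v : R := Num.sqrt (dotv v v).

Definition eball x (r : R) : set 'rV[R]_d := [set y | enorm (y - x) < r].

Definition boundary A : set 'rV[R]_d := closure A `\` A°.

(* A has zero s-dimensional Hausdorff measure.  Only finitely many balls can be
   used when s = 0 and e is finite, and none when e <= 1, so the null sets for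
   s = 0 are the empty ones, as for the counting measure. *)
Definition hausdorff_null (s : nat) A : Prop :=
  forall e delta : R, 0 < e -> 0 < delta ->
    exists (I : set nat) (c : nat -> 'rV[R]_d) (r : nat -> R),
      [/\ forall n, I n -> 0 < r n < delta,
          A `<=` \bigcup_(n in I) eball (c n) (r n)
        & (\esum_(n in I) (r n ^+ s)%:E < e%:E)%E].

(* P holds at almost every point of A for the surface measure. *)
Definition surface_ae A (P : 'rV[R]_d -> Prop) : Prop :=
  hausdorff_null d.-1 [set x | A x /\ ~ P x].

(* De Giorgi-Federer exterior normal: the blow-up of Omega at x is the half
   space (y - x) . n < 0. *)
Definition is_outward_normal (Omega : set 'rV[R]_d) x (n : 'rV[R]_d) : Prop :=
  [/\ enorm n = 1,
      ((r ^- d)%:E * lebesgue_rV d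
        (eball x r `&` Omega `&` [set y | (0 < dotv (y - x) n)%R]))%E
          @[r --> 0^'+] --> 0%E
    & ((r ^- d)%:E * lebesgue_rV d
        (eball x r `&` ~` Omega `&` [set y | (dotv (y - x) n < 0)%R]))%E
          @[r --> 0^'+] --> 0%E].

End euclidean.

Section sobolev.
Context {R : realType} {d : nat} (Omega : set 'rV[R]_d).
Local Notation mu := (lebesgue_rV d).
Implicit Types (f g : 'rV[R]_d -> R) (i j : 'I_d).

Definition evec i : 'rV[R]_d := delta_mx 0 i.

Definition iter_partial (s : seq 'I_d) f : 'rV[R]_d -> R :=
  foldr (fun i h x => 'D_(evec i) h x) f s.

Definition smooth f : Prop :=
  forall s, continuous (iter_partial s f) /\
    forall i x, derivable (iter_partial s f) x (evec i).

Definition test_function f : Prop :=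
  smooth f /\ exists K : set 'rV[R]_d,
    [/\ compact K, K `<=` Omega & forall x, ~ K x -> f x = 0].

Definition loc_integrable f : Prop :=
  forall K : set 'rV[R]_d, compact K -> K `<=` Omega ->
    mu.-integrable K (EFin \o f).

Definition is_weak_partial i f g : Prop :=
  [/\ loc_integrable f, loc_integrable g
    & forall phi, test_function phi ->
      \int[mu]_(x in Omega) (f x * 'D_(evec i) phi x) =
      - \int[mu]_(x in Omega) (g x * phi x)].

(* A representative of the weak partial derivative (it is unique up to
   a null set), and 0 when there is none. *)
Definition weak_partial i f : 'rV[R]_d -> R :=
  xget (fun=> 0) [set g | is_weak_partial i f g].

Definition weak_grad f (x : 'rV[R]_d) : 'rV[R]_d :=
  \row_i weak_partial i f x.

Definition strain (u : 'rV[R]_d -> 'rV[R]_d) (x : 'rV[R]_d) : 'M[R]_d :=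
  \matrix_(i, j) ((weak_partial j (fun y => u y 0 i) x +
                   weak_partial i (fun y => u y 0 j) x) / 2).

(* Elements of the function spaces are functions rather than classes modulo
   equality almost everywhere. *)
Definition L2 f : Prop :=
  measurable_fun Omega f /\ mu.-integrable Omega (fun x => (f x ^+ 2)%:E).

Definition Linfty f : Prop :=
  measurable_fun Omega f /\
  exists M : R, {ae mu, forall x, Omega x -> `|f x| <= M}.

Definition H1 : set ('rV[R]_d -> 'rV[R]_d) :=
  [set u | forall i, L2 (fun x => u x 0 i) /\
     forall j, exists2 g, is_weak_partial j (fun x => u x 0 i) g & L2 g].

Definition W1infty : set ('rV[R]_d -> R) :=
  [set f | Linfty f /\
     forall j, exists2 g, is_weak_partial j f g & Linfty g].

(* h has boundary value 0 at x, as a limit of averages over the part in Omega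
   of small balls. *)
Definition vanishing_mean (h : 'rV[R]_d -> R) (x : 'rV[R]_d) : Prop :=
  ((r ^- d)%:E * \int[mu]_(y in eball x r `&` Omega) (h y)%:E)%E
    @[r --> 0^'+] --> 0%E.

(* u = w on A in the sense of traces.  On Lipschitz domains this pointwise
   description of the trace agrees with the continuous extension of the
   restriction operator. *)
Definition trace_eq (A : set 'rV[R]_d) (u w : 'rV[R]_d -> 'rV[R]_d) : Prop :=
  surface_ae A (fun x => vanishing_mean (fun y => enorm (u y - w x)) x).

End sobolev.

Section phase_field.
Context {R : realType} {d : nat}.
Variables (Omega : set 'rV[R]_d).
Local Notation field := ('rV[R]_d -> 'rV[R]_d).
Local Notation damage := ('rV[R]_d -> R).

Definition homogeneous_fields (V : set field) (Gamma_D : set 'rV[R]_d) :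
    set field :=
  [set u | V u /\ trace_eq Omega Gamma_D u (fun=> 0)].

(* The gradient of a W^{1,infty} function has no trace in general; the Neumann
   condition asks that its normal component has boundary value 0, in the same
   sense as for displacements. *)
Definition damage_space (nu : field) : set damage :=
  [set b | W1infty Omega b /\
     surface_ae (boundary Omega) (fun x =>
       vanishing_mean Omega (fun y => `|dotv (weak_grad Omega b y) (nu x)|) x)].

Definition admissible_damage (nu : field) (b0 : damage) : set damage :=
  [set b | damage_space nu b /\
     {ae lebesgue_rV d, forall x, Omega x -> 0 <= b x <= 1 /\ b0 x <= b x}].

Definition energy (gc ell : R) (degr : R -> R) (psip psim : 'M[R]_d -> R)
    (uDm u : field) (b : damage) : R :=
  \int[lebesgue_rV d]_(x in Omega)
    (degr (b x) * psip (strain Omega (u \+ uDm) x)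
     + psim (strain Omega (u \+ uDm) x)
     + gc * ell / 2 * enorm (weak_grad Omega b x) ^+ 2).

Definition dissipation (gc ell : R) (b b' : damage) : R :=
  \int[lebesgue_rV d]_(x in Omega)
    (gc / (2 * ell) * (b' x ^+ 2 - b x ^+ 2)).

End phase_field.

Definition symmetric_mx {R : realType} {d : nat} : set 'M[R]_d :=
  [set e | e^T = e].

(* psip and psim are the tensile and compressive parts of psi0.  Continuity and
   at most quadratic growth, which hold for the volumetric-deviatoric and the
   spectral splittings, make the energy finite on H^1. *)
Definition energy_split {R : realType} {d : nat}
    (psi0 psip psim : 'M[R]_d -> R) : Prop :=
  [/\ forall e, symmetric_mx e ->
        [/\ 0 <= psip e, 0 <= psim e & psi0 e = psip e + psim e],
      {within symmetric_mx, continuous psip},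
      {within symmetric_mx, continuous psim}
    & exists c : R, forall e, symmetric_mx e ->
        psi0 e <= c * (1 + \tr (e *m e^T))].

Definition degradation_function {R : realType} (g : R -> R) : Prop :=
  [/\ forall x y, 0 <= x -> x <= y -> y <= 1 -> g y <= g x,
      convex_function (`[0, 1]%classic : set R) g,
      [lipschitz g x | x in (`[0, 1]%classic : set R)],
      g 0 = 1 & g 1 = 0].

(* Main.v *)
Require Import Defs.
From mathcomp Require Import all_boot all_order all_algebra.
From mathcomp Require Import all_classical all_reals all_analysis measurable_realfun.
Import Order.TTheory GRing.Theory Num.Theory.
Import numFieldNormedType.Exports.
Local Open Scope classical_set_scope.
Local Open Scope ring_scope.

(** The a.e. constraint [b <= b'] makes the dissipation [D b b'] nonnegative,
and admissibility is transitive along a chain of damage fields, while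
[D b b''] = [D b b'] + [D b' b''].  Hence stability is minimality with the
nonnegative term [D (beta n) (beta n.+1)] dropped.  The upper bound is
minimality of step [n] tested against the previous state [(u n, beta n)],
which is admissible and dissipates nothing.  The lower bound is minimality of
step [n.-1] tested against the next state [(u n.+1, beta n.+1)], after the
common dissipation from [beta n.-1] to [beta n] has been cancelled by
additivity; for [n = 0] the assumed stability of the initial state plays this
role.

Nonnegativity and additivity of [D] rest on splitting its integral into two finite ones
([dissipationE]), that is, on square integrability of bounded fields
([Linfty_L2]).  This needs [Omega] to be measurable for the sigma-algebra
generated by the coordinates ([open_measurable_rV]) and to have finite measure
([bounded_lebesgue_rV_lty]). *)

(** * Open sets and bounded sets of R^d *)

(** The box with sides [J i] in R^d. *)
Definition box_rV {R : realType} {d} (J : 'I_d -> interval R) : set 'rV[R]_d :=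
  [set x | forall i, x 0 i \in J i].

Lemma measurable_box_rV {R : realType} d (J : 'I_d -> interval R) :
  measurable (box_rV J).
Proof.
rewrite (_ : box_rV J =
    \bigcap_(i in [set: 'I_d]) ((fun x : 'rV[R]_d => x 0 i) @^-1` [set` J i])).
  apply: fin_bigcap_measurable => [|i _]; first exact: finite_finset.
  by rewrite -[X in measurable X]setTI; apply: (measurable_rV_coord i).
by apply/seteqP; split=> x /= xJ i; [move=> _; exact: xJ|exact: (xJ i)].
Qed.

(** An open set is the union of the countably many open boxes with rational
corners that it contains. *)
Lemma open_measurable_rV {R : realType} {d} {A : set 'rV[R]_d} :
  open A -> measurable A.
Proof.
move=> oA.
pose B (pq : 'rV[rat]_d * 'rV[rat]_d) : set 'rV[R]_d :=
  box_rV (fun i => `]ratr (pq.1 0 i), ratr (pq.2 0 i)[).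
pose F pq := if pselect (B pq `<=` A) then B pq else set0.
rewrite (_ : A = \bigcup_pq F pq).
  apply: countable_bigcupT_measurable; first exact: countableP.
  move=> pq; rewrite /F; case: pselect => [?|?]; last exact: measurable0.
  exact: measurable_box_rV.
apply/seteqP; split=> [x Ax|x [pq _]]; last first.
  by rewrite /F; case: pselect => // BA; exact: BA.
(* A ball is a cube here, so rational corners within e of x in every
   coordinate, on either side of it, suffice. *)
have /nbhs_ballP[e /= e0 eA] : nbhs x A by exact: open_nbhs_nbhs.
have /fin_all_exists[p px] i : exists q : rat, ratr q \in `]x 0 i - e, x 0 i[.
  by apply: rat_in_itvoo; rewrite ltrBlDr ltrDl.
have /fin_all_exists[q qx] i : exists q : rat, ratr q \in `]x 0 i, x 0 i + e[.
  by apply: rat_in_itvoo; rewrite ltrDl.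
exists (\row_i p i, \row_i q i) => //; rewrite /F; case: pselect => [?|[]].
  move=> i /=; rewrite !mxE in_itv /=.
  by have := px i; have := qx i; rewrite !in_itv /= => /andP[-> _] /andP[_ ->].
move=> y yB; apply: eA; split => // i j; rewrite (ord1 i) -ball_normE /=.
have := yB j; have := px j; have := qx j; rewrite /= !mxE !in_itv /=.
move=> /andP[_ q2] /andP[p1 _] /andP[py yq].
rewrite ltr_distlC; apply/andP; split; first exact: lt_trans py.
exact: lt_trans q2.
Qed.

(** By induction on the dimension, as the measure is an iterated product. *)
Lemma lebesgue_cube_lty {R : realType} d (M : R) :
  (lebesgue_rV d (box_rV (fun=> `[- M, M]%R)) < +oo)%E.
Proof.
elim: d => [|d IH] /=.
  by rewrite /lebesgue_zero diracE ltry.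
rewrite /lebesgue_succ /pushforward.
rewrite (_ : _ @^-1` _ = [set` `[- M, M]] `*` box_rV (fun=> `[- M, M])).
  rewrite product_measure1E//; last exact: measurable_box_rV.
  rewrite lte_mul_pinfty//.
    rewrite ge0_fin_numE//= lebesgue_measure_itv/=.
    by case: ifP => _; rewrite -?EFinD ltry.
apply/seteqP; split=> -[a x] /=.
  move=> ax; split => [|i].
    by have := ax ord0; rewrite /rV_cons mxE unlift_none.
  by have := ax (lift ord0 i); rewrite /rV_cons mxE liftK.
by move=> [aM xM] i; rewrite /rV_cons mxE; case: unliftP => [j|] _ //=.
Qed.

Lemma bounded_lebesgue_rV_lty {R : realType} {d} {A : set 'rV[R]_d} :
  measurable A -> bounded_set A -> (lebesgue_rV d A < +oo)%E.
Proof.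
move=> mA [M [Mr MA]]; have {}MA : A `<=` [set x | `|x| <= M + 1].
  by move=> x; apply: MA; rewrite ltrDl.
apply: le_lt_trans (lebesgue_cube_lty d (M + 1)).
apply: le_measure; rewrite ?inE//; first exact: measurable_box_rV.
move=> x Ax i; rewrite in_itv /= -ler_norml.
apply: le_trans (MA x Ax); rewrite /Num.norm /= mx_normrE.
by apply: le_trans (le_bigmax _ _ (ord0, i)).
Qed.

(** * Square integrability of bounded functions *)

Section square_integrable.
Context {R : realType} {d : nat} {Omega : set 'rV[R]_d}.
Hypotheses (mO : measurable Omega) (fO : (lebesgue_rV d Omega < +oo)%E).
Local Notation mu := (lebesgue_rV d).
Implicit Types f b : 'rV[R]_d -> R.

Lemma Linfty_L2 f : Linfty Omega f -> L2 Omega f.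
Proof.
move=> [mf [M fM]]; split => //.
have /measurable_EFinP mf2 := measurable_funX 2 mf.
apply/integrableP; split => //.
apply: (@le_lt_trans _ _ (\int[mu]_(x in Omega) (M ^+ 2)%:E)%E).
  apply: ae_ge0_le_integral => //.
  - exact: measurableT_comp.
  - by move=> x _; rewrite lee_fin sqr_ge0.
  apply: filterS fM => x fM Ox; rewrite gee0_abs ?lee_fin ?sqr_ge0//.
  have := fM Ox; move: (f x) => y yM; rewrite -[_ ^+ 2]real_normK ?num_real//.
  by rewrite lerXn2r// nnegrE (le_trans _ yM).
by rewrite integral_cst// lte_mul_pinfty// ?lee_fin ?sqr_ge0.
Qed.

Lemma le_Rintegral_sqr f1 f2 : L2 Omega f1 -> L2 Omega f2 ->
  {ae mu, forall x, Omega x -> 0 <= f1 x <= f2 x} ->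
  \int[mu]_(x in Omega) f1 x ^+ 2 <= \int[mu]_(x in Omega) f2 x ^+ 2.
Proof.
move=> [_ i1] [_ i2] le12; apply: fine_le; [exact: integrable_fin_num..|].
apply: ae_ge0_le_integral => //.
- by move=> x _; rewrite lee_fin sqr_ge0.
- exact: measurable_int i1.
- by move=> x _; rewrite lee_fin sqr_ge0.
- exact: measurable_int i2.
apply: filterS le12 => x le12 Ox; have /andP[f0 f12] := le12 Ox.
by rewrite lee_fin lerXn2r// nnegrE (le_trans f0).
Qed.

(** * The dissipation *)

Lemma dissipationE gc ell b b' : L2 Omega b -> L2 Omega b' ->
  dissipation Omega gc ell b b' =
  gc / (2 * ell) * (\int[mu]_(x in Omega) b' x ^+ 2
                    - \int[mu]_(x in Omega) b x ^+ 2).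
Proof.
move=> [_ ib] [_ ib']; rewrite /dissipation RintegralZl//; last first.
  by rewrite (_ : _ \o _ = (fun x => (b' x ^+ 2)%:E) \- (fun x => (b x ^+ 2)%:E))%E//;
    exact: integrableB.
by rewrite RintegralB.
Qed.

Lemma dissipation_ge0 gc ell b b' : 0 < gc -> 0 < ell ->
  L2 Omega b -> L2 Omega b' ->
  {ae mu, forall x, Omega x -> 0 <= b x <= b' x} ->
  0 <= dissipation Omega gc ell b b'.
Proof.
move=> gc0 ell0 Lb Lb' bb'; rewrite dissipationE//.
rewrite mulr_ge0 ?subr_ge0 ?le_Rintegral_sqr//.
by rewrite divr_ge0 ?mulr_ge0// ltW.
Qed.

Lemma dissipationD gc ell b1 b2 b3 :
  L2 Omega b1 -> L2 Omega b2 -> L2 Omega b3 ->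
  dissipation Omega gc ell b1 b3 =
  dissipation Omega gc ell b1 b2 + dissipation Omega gc ell b2 b3.
Proof.
by move=> L1 L2 L3; rewrite !dissipationE// -mulrDr [in RHS]addrC subrKA.
Qed.

End square_integrable.

(** No integrability is needed: the integrand vanishes identically. *)
Lemma dissipation_refl {R : realType} d (Omega : set 'rV[R]_d) gc ell b :
  dissipation Omega gc ell b b = 0.
Proof.
rewrite /dissipation; under eq_Rintegral do rewrite subrr mulr0.
by rewrite /Rintegral integral0.
Qed.

(** * Admissible damage fields *)

Lemma admissible_damage_trans {R : realType} {d} {Omega : set 'rV[R]_d} {nu}
    {b0 b1 b2} :
  admissible_damage Omega nu b0 b1 -> admissible_damage Omega nu b1 b2 ->
  admissible_damage Omega nu b0 b2.
Proof.
move=> [_ ae1] [B2 ae2]; split => //.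
apply: filterS2 ae1 ae2 => x h1 h2 Ox.
have [_ b01] := h1 Ox; have [? b12] := h2 Ox.
by split => //; exact: le_trans b12.
Qed.

Lemma admissible_damage_refl {R : realType} d (Omega : set 'rV[R]_d) nu b :
  damage_space Omega nu b ->
  {ae lebesgue_rV d, forall x, Omega x -> 0 <= b x <= 1} ->
  admissible_damage Omega nu b b.
Proof.
by move=> Bb b01; split => //; apply: filterS b01 => x b01 /b01.
Qed.

(** * Energy estimates *)

Theorem proposition3p3 (R : realType) (d : nat)
    (Omega Gamma_D : set 'rV[R]_d) (nu : 'rV[R]_d -> 'rV[R]_d)
    (T : R) (N : nat) (t : nat -> R)
    (w : 'rV[R]_d -> R -> 'rV[R]_d)
    (V : set ('rV[R]_d -> 'rV[R]_d)) (uD : nat -> 'rV[R]_d -> 'rV[R]_d)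
    (gc ell k : R) (g : R -> R) (psi0 psip psim : 'M[R]_d -> R)
    (u : nat -> 'rV[R]_d -> 'rV[R]_d) (beta : nat -> 'rV[R]_d -> R) :
  (1 <= d <= 3)%N ->
  open Omega -> connected Omega -> Omega !=set0 -> bounded_set Omega ->
  Gamma_D `<=` boundary Omega ->
  surface_ae (boundary Omega) (fun x => is_outward_normal Omega x (nu x)) ->
  (0 < N)%N -> t 0%N = 0 -> t N = T ->
  (forall m, (m < N)%N -> t m < t m.+1) ->
  V `<=` H1 Omega -> V (fun=> 0) ->
  (forall a v1 v2, V v1 -> V v2 -> V (fun x => a *: v1 x + v2 x)) ->
  (forall m, (m <= N)%N ->
    V (uD m) /\ trace_eq Omega Gamma_D (uD m) (fun x => w x (t m))) ->
  0 < gc -> 0 < ell -> 0 < k ->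
  degradation_function g -> energy_split psi0 psip psim ->
  let V0 := homogeneous_fields Omega V Gamma_D in
  let C := fun n => admissible_damage Omega nu (beta n) in
  let E := fun m => energy Omega gc ell (fun s => g s + k) psip psim (uD m) in
  let D := dissipation Omega gc ell in
  V0 (u 0%N) -> damage_space Omega nu (beta 0%N) ->
  {ae lebesgue_rV d, forall x, Omega x -> 0 <= beta 0%N x <= 1} ->
  (forall n, (n < N)%N ->
    [/\ V0 (u n.+1), C n (beta n.+1) &
      forall v b, V0 v -> C n b ->
        E n.+1 (u n.+1) (beta n.+1) + D (beta n) (beta n.+1) <=
        E n.+1 v b + D (beta n) b]) ->
  forall n, (n < N)%N ->
  [/\ forall v b, V0 v -> C n b ->
        E n.+1 (u n.+1) (beta n.+1) <= E n.+1 v b + D (beta n) b,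
      E n.+1 (u n.+1) (beta n.+1) - E n (u n) (beta n)
        + D (beta n) (beta n.+1) <=
      E n.+1 (u n) (beta n) - E n (u n) (beta n)
    & (* for n = 0 the lower bound needs the initial state to be stable at t 0 *)
      ((0 < n)%N \/
       forall v b, V0 v -> C 0%N b ->
         E 0%N (u 0%N) (beta 0%N) <= E 0%N v b + D (beta 0%N) b) ->
      E n.+1 (u n.+1) (beta n.+1) - E n (u n) (beta n)
        + D (beta n) (beta n.+1) >=
      E n.+1 (u n.+1) (beta n.+1) - E n (u n.+1) (beta n.+1)].
Proof.
move=> _ oO _ _ bO _ _ _ _ _ _ _ _ _ _ gc0 ell0 _ _ _ V0 C E D.
(* Of V0 and E, only the minimality hypotheses are used. *)
clearbody V0 E.
move=> V0u0 B0 beta01 Hmin.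
have mO := open_measurable_rV oO.
have fO := bounded_lebesgue_rV_lty mO bO.
have BL b : damage_space Omega nu b -> L2 Omega b.
  by case=> -[bL _] _; exact: Linfty_L2.
have V0u n : (n <= N)%N -> V0 (u n).
  by case: n => [_|n nN]; [exact: V0u0|have [+ _ _] := Hmin n nN].
have Bbeta n : (n <= N)%N -> damage_space Omega nu (beta n).
  by case: n => [_|n nN]; [exact: B0|have [_ [+ _] _] := Hmin n nN].
have Cbeta n : (n <= N)%N -> C n (beta n).
  move=> nN; apply: admissible_damage_refl; first exact: Bbeta.
  case: n nN => [_|n nN]; first exact: beta01.
  have [_ [_ ae01] _] := Hmin n nN.
  by apply: filterS ae01 => x h /h[].
have D0 n b : (n < N)%N -> C n b -> 0 <= D (beta n) b.
  move=> nN Cnb; apply: dissipation_ge0 => //.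
  - exact/BL/Bbeta/ltnW.
  - by apply: BL; case: Cnb.
  have [_ bn01] := Cbeta n (ltnW nN); have [_ bb] := Cnb.
  apply: filterS2 bn01 bb => x h1 h2 Ox.
  by have [/andP[-> _] _] := h1 Ox; have [_ ->] := h2 Ox.
move=> n nN; have [V0un1 Cn1 minn] := Hmin n nN; split.
- move=> v b V0v Cb; apply: le_trans (minn v b V0v Cb).
  by rewrite lerDl D0.
- have := minn (u n) (beta n) (V0u n (ltnW nN)) (Cbeta n (ltnW nN)).
  rewrite [D (beta n) (beta n)]dissipation_refl addr0 => le_n.
  by rewrite addrAC lerD2r.
- move=> stab.
  suff le_n : E n (u n) (beta n) <=
      E n (u n.+1) (beta n.+1) + D (beta n) (beta n.+1).
    by rewrite -addrA lerD2l addrC -lerBlDr opprK addrC lerBlDr addrC.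
  case: n nN V0un1 Cn1 stab {minn} => [|m] mN V0u2 Cm2.
    by case=> // stab; exact: stab.
  move=> _; have [_ Cm1 minm] := Hmin m (ltnW mN).
  (* The state at n.+1 competes at the previous step. *)
  have := minm _ _ V0u2 (admissible_damage_trans Cm1 Cm2).
  rewrite [D (beta m) (beta m.+2)](@dissipationD _ _ _ mO _ _ _ (beta m.+1)).
  + by rewrite addrCA [leRHS]addrC lerD2r.
  + exact/BL/Bbeta/ltnW/ltnW.
  + exact/BL/Bbeta/ltnW.
  + exact/BL/Bbeta.
Qed.
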